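(* Consider the first order linear difference equation $$y(t+1)-\lambda y(t)=f(t),\qquad \lambda\neq 0,$$ where $f:\mathbb{R}\to\mathbb{R}$ is a given function of the real variable $t$. Then a particular solution of this equation is given by $$y_p(t)=\sum_{s=1}^{\lfloor t\rfloor}\lambda^{s-1}f(t-s).$$
   Context: $\lambda$ is a nonzero constant, and $\lfloor t\rfloor$ is the usual floor function. A sum whose upper limit is smaller than its lower limit equals $0$, so $y_p(t)=0$ for $t<1$.
   Formalization: The equation is asserted only for t ≥ 0: for t < 0 both y_p(t+1) and y_p(t) are empty sums, so the left side is 0 and the equation fails whenever f(t) ≠ 0. *)

(* Defs.v *)
From mathcomp Require Import all_boot all_order all_algebra.
From mathcomp Require Import reals.

Set Implicit Arguments.
Unset Strict Implicit.
Unset Printing Implicit Defensive.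

Import Order.TTheory GRing.Theory Num.Theory.
Local Open Scope ring_scope.

(* [D] is the set of times at which the equation is required to hold; [y]
   itself is a total function, so [y (t + 1)] makes sense even when [t + 1]
   lies outside [D]. *)
Definition solves_difference_eq (R : realType) (D : R -> Prop)
    (lambda : R) (f y : R -> R) : Prop :=
  forall t : R, D t -> y (t + 1) - lambda * y t = f t.

(* The number of terms is the positive part of the floor, so the sum is empty,
   and its value 0, whenever [t < 1]. *)
Definition particular_solution (R : realType) (lambda : R) (f : R -> R)
    (t : R) : R :=
  \sum_(1 <= s < `|(Num.max 0 (Num.floor t))%R|%N.+1)
     lambda ^+ (s - 1) * f (t - s%:R).

(* Main.v *)
Require Import Defs.
From mathcomp Require Import all_boot all_order all_algebra.
From mathcomp Require Import reals.

Import Order.TTheory GRing.Theory Num.Theory.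
Local Open Scope ring_scope.

(** For [t >= 0], passing to [t + 1] adds exactly one term to the sum: its [s = 1] term is [f t],
    and its remaining terms, reindexed by one, are [lambda] times the sum at [t]. *)

Theorem theorem2p1 (R : realType) (lambda : R) (f : R -> R)
    (lambda_neq0 : lambda != 0) :
  solves_difference_eq (fun t : R => 0 <= t) lambda f
    (particular_solution lambda f).
Proof.
move=> t t_ge0; rewrite /particular_solution.
have : 0 <= Num.floor t by rewrite floor_ge0.
have -> : Num.floor (t + 1) = Num.floor t + 1.
  by rewrite floorDrz ?floor1 ?rpred1.
(* With the floor a natural number [n], both truncations by [Num.max 0] vanish. *)
case: (Num.floor t) => // n _.
rewrite -PoszD addn1 !max_r //=.
rewrite big_nat_recl // subnn expr0 mul1r addrK mulr_sumr.
apply/eqP; rewrite subr_eq; apply/eqP; congr (_ + _).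
(* Index 0 is out of range, so the natural subtraction [s - 1] never truncates. *)
apply: eq_big_nat => -[//|s] _.
by rewrite !subn1 /= exprS mulrA -(natr1 s.+1) opprD addrACA subrr addr0.
Qed.
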